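(* Let $t$ be an LSC term and $\rho : t\to_{LOU}^* u$ a derivation made of leftmost-outermost useful steps. Then there is a leftmost-outermost $\beta$-derivation $\rho\!\downarrow : t\!\downarrow \to_\beta^* u\!\downarrow$ such that $|\rho\!\downarrow| = |\rho|_{\tt dB}$.
   Context: LSC terms: $t::= x\mid \lambda x.t\mid tu\mid t[x\leftarrow u]$ ($[x\leftarrow u]$ an explicit substitution (ES) binding $x$), modulo $\alpha$. Shallow contexts $C::=\langle\cdot\rangle\mid \lambda x.C\mid Ct\mid tC\mid C[x\leftarrow t]$; general contexts additionally allow $t[x\leftarrow C]$; substitution contexts $L::=\langle\cdot\rangle\mid L[x\leftarrow t]$; applicative contexts $A::=C\langle L\, t\rangle$. LSC reduction: closure under shallow contexts of ${\tt dB}$: $(L\langle\lambda x.t\rangle)u\to L\langle t[x\leftarrow u]\rangle$ and ${\tt ls}$: $C\langle x\rangle[x\leftarrow u]\to C\langle u\rangle[x\leftarrow u]$ ($C$ not capturing $x$). An ${\tt ls}$-step $D\langle C\langle x\rangle[x\leftarrow u]\rangle\to D\langle C\langle u\rangle[x\leftarrow u]\rangle$ is written compactly $E\langle x\rangle\to E\langle u\rangle$ with $E=D\langle C[x\leftarrow u]\rangle$. Unfolding: $x\!\downarrow=x$, $(tu)\!\downarrow=t\!\downarrow u\!\downarrow$, $(\lambda x.t)\!\downarrow=\lambda x.t\!\downarrow$, $(t[x\leftarrow u])\!\downarrow=t\!\downarrow\{x\leftarrow u\!\downarrow\}$. Relative unfolding: $t\!\downarrow_{\langle\cdot\rangle}=t\!\downarrow$,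 $t\!\downarrow_{uC}=t\!\downarrow_{Cu}=t\!\downarrow_{\lambda x.C}=t\!\downarrow_C$, $t\!\downarrow_{C[x\leftarrow u]}=t\!\downarrow_C\{x\leftarrow u\!\downarrow\}$. A step is useful if it is a ${\tt dB}$-step, or an ${\tt ls}$-step $C\langle x\rangle\to C\langle r\rangle$ (compact form) such that $r\!\downarrow_C$ contains a $\beta$-redex, or $r\!\downarrow_C$ is an abstraction and $C$ is an applicative context. Position of a redex: for a ${\tt dB}$-redex $C\langle L\langle \lambda x.t\rangle u\rangle$ (and likewise a $\beta$-redex) it is $C$; for an ${\tt ls}$-redex in compact form $C\langle x\rangle\to C\langle u\rangle$ it is $C$. Write $C\prec_p t$ if $t=C\langle u\rangle$ for some $u$. Outside-in order: $\langle\cdot\rangle\prec_O C$ for all $C\neq\langle\cdot\rangle$, and $C\prec_O D$ implies $E\langle C\rangle\prec_O E\langle D\rangle$. Left-to-right order: if $C\prec_p t$ and $D\prec_p u$ then $Cu\prec_L tD$ and $C[x\leftarrow u]\prec_L t[x\leftarrow D]$, closed under $C\prec_L D\Rightarrow E\langle C\rangle\prec_L E\langle D\rangle$. $C\prec_{LO}D$ iff $C\prec_O D$ or $C\prec_L D$; redexes are ordered by their positions. The LOU (leftmost-outermost useful) redex of $t$ is the useful redex $R$ with $R\prec_{LO}Q$ for every other useful redex $Q$; $\to_{LOU}$ reduces it. $|\rho|_{\tt dB}$ is the number of ${\tt dB}$-steps of $\rho$, $|\cdot|$ the length of a derivation. *)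

(* Defs.v *)
From Stdlib Require Import Arith.

(* Terms modulo alpha are represented with de Bruijn indices. *)

(* [Sub t u] is the explicit substitution t[x<-u]: index 0 of [t] is x, and
   [u] is outside the scope of x. *)
Inductive term : Type :=
| Var (n : nat)
| Lam (t : term)
| App (t u : term)
| Sub (t u : term).

Definition up_ren (f : nat -> nat) (n : nat) : nat :=
  match n with 0 => 0 | S m => S (f m) end.

Fixpoint ren (f : nat -> nat) (t : term) : term :=
  match t with
  | Var n => Var (f n)
  | Lam t => Lam (ren (up_ren f) t)
  | App t u => App (ren f t) (ren f u)
  | Sub t u => Sub (ren (up_ren f) t) (ren f u)
  end.

Definition lift (k : nat) : term -> term := ren (Nat.add k).

Definition scons (u : term) (s : nat -> term) (n : nat) : term :=
  match n with 0 => u | S m => s m end.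

Definition up (s : nat -> term) : nat -> term :=
  scons (Var 0) (fun n => lift 1 (s n)).

Fixpoint subst (s : nat -> term) (t : term) : term :=
  match t with
  | Var n => s n
  | Lam t => Lam (subst (up s) t)
  | App t u => App (subst s t) (subst s u)
  | Sub t u => Sub (subst (up s) t) (subst s u)
  end.

(* Meta-level substitution t{x<-u}, where x is the variable of [t] with index
   [k]: smaller indices are kept, larger ones are decremented. *)
Definition msubst (k : nat) (u t : term) : term :=
  subst (Nat.iter k up (scons u Var)) t.

(* General contexts. *)
Inductive ctx : Type :=
| Hole
| CLam (C : ctx)
| CAppL (C : ctx) (t : term)
| CAppR (t : term) (C : ctx)
| CSubL (C : ctx) (t : term)
| CSubR (t : term) (C : ctx).

(* Plugging is literal replacement, hence capturing: the plugged term lives in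
   the scope of the hole. *)
Fixpoint plug (C : ctx) (s : term) : term :=
  match C with
  | Hole => s
  | CLam C => Lam (plug C s)
  | CAppL C t => App (plug C s) t
  | CAppR t C => App t (plug C s)
  | CSubL C t => Sub (plug C s) t
  | CSubR t C => Sub t (plug C s)
  end.

(* E<C> *)
Fixpoint comp (E C : ctx) : ctx :=
  match E with
  | Hole => C
  | CLam E => CLam (comp E C)
  | CAppL E t => CAppL (comp E C) t
  | CAppR t E => CAppR t (comp E C)
  | CSubL E t => CSubL (comp E C) t
  | CSubR t E => CSubR t (comp E C)
  end.

(* Number of binders, of either sort, whose scope contains the hole. *)
Fixpoint depth (C : ctx) : nat :=
  match C with
  | Hole => 0
  | CLam C => S (depth C)
  | CAppL C _ => depth C
  | CAppR _ C => depth C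
  | CSubL C _ => S (depth C)
  | CSubR _ C => depth C
  end.

Fixpoint lam_depth (C : ctx) : nat :=
  match C with
  | Hole => 0
  | CLam C => S (lam_depth C)
  | CAppL C _ => lam_depth C
  | CAppR _ C => lam_depth C
  | CSubL C _ => lam_depth C
  | CSubR _ C => lam_depth C
  end.

Fixpoint shallow (C : ctx) : Prop :=
  match C with
  | Hole => True
  | CLam C => shallow C
  | CAppL C _ => shallow C
  | CAppR _ C => shallow C
  | CSubL C _ => shallow C
  | CSubR _ _ => False
  end.

Fixpoint subst_ctx (L : ctx) : Prop :=
  match L with
  | Hole => True
  | CSubL L _ => subst_ctx L
  | _ => False
  end.

Definition applicative (A : ctx) : Prop :=
  exists C L t, shallow C /\ subst_ctx L /\ A = comp C (CAppL L t).

Fixpoint unf (t : term) : term :=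
  match t with
  | Var n => Var n
  | Lam t => Lam (unf t)
  | App t u => App (unf t) (unf u)
  | Sub t u => msubst 0 (unf u) (unf t)
  end.

(* [rel_unf t C] is t unfolded relatively to C.  The substitution variables of
   C are eliminated but its abstracted variables stay free, so the result lives
   in the scope of C extended with [lam_depth C] variables; hence the variable
   x of C[x<-u] has index [lam_depth C] in [rel_unf t C].
   Only shallow C are meaningful; the clause for [CSubR] is never used. *)
Fixpoint rel_unf (t : term) (C : ctx) : term :=
  match C with
  | Hole => unf t
  | CLam C => rel_unf t C
  | CAppL C _ => rel_unf t C
  | CAppR _ C => rel_unf t C
  | CSubL C u =>
      msubst (lam_depth C) (unf u) (rel_unf t C)
  | CSubR _ C => rel_unf t C
  end.

Fixpoint lambda_term (t : term) : Prop :=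
  match t with
  | Var _ => True
  | Lam t => lambda_term t
  | App t u => lambda_term t /\ lambda_term u
  | Sub _ _ => False
  end.

(* [beta_step C t t']: t reduces to t' by firing the beta-redex of position C.
   Since t has no explicit substitution, neither has C. *)
Inductive beta_step : ctx -> term -> term -> Prop :=
| beta_at C s v :
    lambda_term (plug C (App (Lam s) v)) ->
    beta_step C (plug C (App (Lam s) v)) (plug C (msubst 0 v s)).

Definition has_beta_redex (t : term) : Prop := exists C t', beta_step C t t'.

Definition is_abs (t : term) : Prop := exists s, t = Lam s.

Inductive kind : Type := DB | LS.

(* E<x> -> E<r> is an ls-step in compact form, with E = D<C[x<-u]>.  At the hole
   of C, x has index [depth C], and r is u brought under the binders of C and
   under that of x. *)
Definition ls_compact (E : ctx) (x : nat) (r : term) : Prop :=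
  exists D C u, shallow D /\ shallow C /\
    E = comp D (CSubL C u) /\ x = depth C /\ r = lift (S (depth C)) u.

(* [lsc_step k C t t']: t reduces to t' by firing the redex of kind k and
   position C. *)
Inductive lsc_step : kind -> ctx -> term -> term -> Prop :=
| step_dB C L s v :
    shallow C -> subst_ctx L ->
    lsc_step DB C (plug C (App (plug L (Lam s)) v))
                  (plug C (plug L (Sub s (lift (depth L) v))))
| step_ls E x r :
    ls_compact E x r -> lsc_step LS E (plug E (Var x)) (plug E r).

Definition useful_step (k : kind) (C : ctx) (t t' : term) : Prop :=
  lsc_step k C t t' /\
  (k = DB \/
   k = LS /\ exists r, t' = plug C r /\
     (has_beta_redex (rel_unf r C) \/
      is_abs (rel_unf r C) /\ applicative C)).

Definition prec_p (C : ctx) (t : term) : Prop := exists u, t = plug C u.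

Inductive prec_O : ctx -> ctx -> Prop :=
| prec_O_hole C : C <> Hole -> prec_O Hole C
| prec_O_ctx E C D : prec_O C D -> prec_O (comp E C) (comp E D).

Inductive prec_L : ctx -> ctx -> Prop :=
| prec_L_app C D t u :
    prec_p C t -> prec_p D u -> prec_L (CAppL C u) (CAppR t D)
| prec_L_sub C D t u :
    prec_p C t -> prec_p D u -> prec_L (CSubL C u) (CSubR t D)
| prec_L_ctx E C D : prec_L C D -> prec_L (comp E C) (comp E D).

Definition prec_LO (C D : ctx) : Prop := prec_O C D \/ prec_L C D.

(* In a given term a redex is determined by its kind and position. *)
Definition lou_step (R : kind * ctx) (t t' : term) : Prop :=
  useful_step (fst R) (snd R) t t' /\
  forall Q s, useful_step (fst Q) (snd Q) t s -> Q <> R ->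
    prec_LO (snd R) (snd Q).

Definition lo_beta_step (C : ctx) (t t' : term) : Prop :=
  beta_step C t t' /\
  forall D s, beta_step D t s -> D <> C -> prec_LO C D.

(* Derivations for a reduction whose steps are labelled by redexes. *)
Inductive derivation {X : Type} (step : X -> term -> term -> Prop) :
    term -> term -> Type :=
| deriv_nil t : derivation step t t
| deriv_cons R t s u :
    step R t s -> derivation step s u -> derivation step t u.

Arguments deriv_nil {X step} t.
Arguments deriv_cons {X step} R {t s u} _ _.

Fixpoint deriv_length {X : Type} {step : X -> term -> term -> Prop}
    {t u : term} (rho : derivation step t u) : nat :=
  match rho with
  | deriv_nil _ => 0
  | deriv_cons _ _ rho => S (deriv_length rho)
  end.

Fixpoint dB_length {step : kind * ctx -> term -> term -> Prop}
    {t u : term} (rho : derivation step t u) : nat :=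
  match rho with
  | deriv_nil _ => 0
  | deriv_cons (DB, _) _ rho => S (dB_length rho)
  | deriv_cons (LS, _) _ rho => dB_length rho
  end.

(* Main.v *)
From Stdlib Require Import Arith Lia.
Require Import Defs.

(** Every term on the shallow part of t has a trace in the unfolding: a
    subterm w at a shallow position E of t occurs in the unfolding of t as w
    unfolded relatively to E.  If this relative unfolding has a beta-redex,
    then w itself contains a useful redex of t: the beta-redex either comes
    from a dB-redex, or is created by substituting a variable, and then the
    ls-step on that variable is useful.  So the part of the unfolding which
    precedes the image of a leftmost-outermost useful dB-redex has no
    beta-redex, that is, this image is the leftmost-outermost beta-redex.
    The ls-steps do not change the unfolding. *)

(** * Substitution *)

Lemma ren_ext (t : term) : forall f g,
  (forall n, f n = g n) -> ren f t = ren g t.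
Proof.
  induction t as [n|t IH|t IHt u IHu|t IHt u IHu]; intros f g H; simpl; f_equal;
    auto; try apply IH; try apply IHt; intros [|n]; simpl; auto.
Qed.

Lemma ren_ren (t : term) : forall f g,
  ren g (ren f t) = ren (fun n => g (f n)) t.
Proof.
  induction t as [n|t IH|t IHt u IHu|t IHt u IHu]; intros f g; simpl; f_equal;
    auto; rewrite ?IH, ?IHt; apply ren_ext; intros [|n]; reflexivity.
Qed.

Lemma subst_ext (t : term) : forall s s',
  (forall n, s n = s' n) -> subst s t = subst s' t.
Proof.
  induction t as [n|t IH|t IHt u IHu|t IHt u IHu]; intros s s' H; simpl; f_equal;
    auto; try apply IH; try apply IHt; intros [|n]; simpl; auto;
    now rewrite H.
Qed.

Lemma subst_ren (t : term) : forall f s,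
  subst s (ren f t) = subst (fun n => s (f n)) t.
Proof.
  induction t as [n|t IH|t IHt u IHu|t IHt u IHu]; intros f s; simpl; f_equal;
    auto; rewrite ?IH, ?IHt; apply subst_ext; intros [|n]; reflexivity.
Qed.

Lemma ren_subst (t : term) : forall f s,
  ren f (subst s t) = subst (fun n => ren f (s n)) t.
Proof.
  induction t as [n|t IH|t IHt u IHu|t IHt u IHu]; intros f s; simpl; f_equal;
    auto; rewrite ?IH, ?IHt; apply subst_ext; intros [|n]; simpl; auto;
    unfold lift; rewrite !ren_ren; reflexivity.
Qed.

Lemma subst_subst (t : term) : forall s s',
  subst s' (subst s t) = subst (fun n => subst s' (s n)) t.
Proof.
  induction t as [n|t IH|t IHt u IHu|t IHt u IHu]; intros s s'; simpl; f_equal;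
    auto; rewrite ?IH, ?IHt; apply subst_ext; intros [|n]; simpl; auto;
    unfold lift; rewrite subst_ren, ren_subst; reflexivity.
Qed.

Lemma subst_Var (t : term) : forall s,
  (forall n, s n = Var n) -> subst s t = t.
Proof.
  induction t as [n|t IH|t IHt u IHu|t IHt u IHu]; intros s H; simpl; f_equal;
    auto; try apply IH; try apply IHt; intros [|n]; simpl; auto;
    now rewrite H.
Qed.

Lemma ren_as_subst (t : term) (f : nat -> nat) :
  ren f t = subst (fun n => Var (f n)) t.
Proof.
  rewrite <- (subst_Var (ren f t) Var) by reflexivity.
  apply subst_ren.
Qed.

Lemma lift0 (t : term) : lift 0 t = t.
Proof. unfold lift; rewrite ren_as_subst; now apply subst_Var. Qed.

Lemma lift_lift (j k : nat) (t : term) : lift j (lift k t) = lift (j + k) t.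
Proof. unfold lift; rewrite ren_ren; apply ren_ext; intro n; lia. Qed.

Lemma subst_msubst (s : nat -> term) (u t : term) :
  subst s (msubst 0 u t) = msubst 0 (subst s u) (subst (up s) t).
Proof.
  unfold msubst; simpl; rewrite !subst_subst; apply subst_ext.
  intros [|n]; simpl; auto.
  unfold lift; rewrite subst_ren; symmetry; now apply subst_Var.
Qed.

Lemma ren_msubst (f : nat -> nat) (u t : term) :
  ren f (msubst 0 u t) = msubst 0 (ren f u) (ren (up_ren f) t).
Proof.
  unfold msubst; simpl; rewrite ren_subst, subst_ren; apply subst_ext.
  intros [|n]; reflexivity.
Qed.

Lemma iter_up_lt (k : nat) (s : nat -> term) : forall y,
  y < k -> Nat.iter k up s y = Var y.
Proof.
  induction k as [|k IH]; intros y H; [lia|].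
  destruct y as [|y]; simpl; auto.
  now rewrite IH by lia.
Qed.

Lemma iter_up_add (k : nat) (s : nat -> term) (n : nat) :
  Nat.iter k up s (k + n) = lift k (s n).
Proof.
  induction k as [|k IH]; simpl.
  - now rewrite lift0.
  - now rewrite IH, lift_lift.
Qed.

(** The index [k] is skipped by the two lifts, so the substitution finds no occurrence and only
    undoes the lift by one. *)
Lemma msubst_lift (k : nat) (u t : term) :
  msubst k u (lift k (lift 1 t)) = lift k t.
Proof.
  unfold msubst; rewrite lift_lift; unfold lift.
  rewrite subst_ren, (ren_as_subst t); apply subst_ext; intro n.
  now rewrite <- Nat.add_assoc, iter_up_add.
Qed.

Lemma msubst_Var_eq (k : nat) (u : term) : msubst k u (Var k) = lift k u.
Proof.
  generalize (iter_up_add k (scons u Var) 0); now rewrite Nat.add_0_r.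
Qed.

Lemma unf_ren (t : term) : forall f, unf (ren f t) = ren f (unf t).
Proof.
  induction t as [n|t IH|t IHt u IHu|t IHt u IHu]; intro f; simpl.
  - reflexivity.
  - now rewrite IH.
  - now rewrite IHt, IHu.
  - now rewrite IHt, IHu, ren_msubst.
Qed.

Lemma unf_lift (k : nat) (t : term) : unf (lift k t) = lift k (unf t).
Proof. apply unf_ren. Qed.

Lemma lambda_term_ren (t : term) : forall f,
  lambda_term t -> lambda_term (ren f t).
Proof. induction t; simpl; auto; intros f [H1 H2]; auto. Qed.

Lemma lambda_term_subst (t : term) : forall s,
  (forall n, lambda_term (s n)) -> lambda_term t -> lambda_term (subst s t).
Proof.
  induction t as [n|t IH|t IHt u IHu|t IHt u IHu]; intros s Hs Ht; simpl in *.
  - apply Hs.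
  - apply IH; auto.
    intros [|n]; simpl; auto; now apply lambda_term_ren.
  - destruct Ht; auto.
  - contradiction.
Qed.

Lemma lambda_term_unf (t : term) : lambda_term (unf t).
Proof.
  induction t as [n|t IH|t IHt u IHu|t IHt u IHu]; simpl; auto.
  apply lambda_term_subst; auto.
  intros [|n]; simpl; auto.
Qed.

(** * Contexts and relative unfolding *)

Lemma comp_assoc (E C D : ctx) : comp (comp E C) D = comp E (comp C D).
Proof. induction E; simpl; congruence. Qed.

Lemma comp_Hole (E : ctx) : comp E Hole = E.
Proof. induction E; simpl; congruence. Qed.

Lemma plug_comp (E C : ctx) (t : term) : plug (comp E C) t = plug E (plug C t).
Proof. induction E; simpl; congruence. Qed.

Lemma shallow_comp (E C : ctx) : shallow E -> shallow C -> shallow (comp E C).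
Proof. induction E; simpl; auto. Qed.

Lemma subst_ctx_shallow (L : ctx) : subst_ctx L -> shallow L.
Proof. induction L; simpl; tauto. Qed.

Lemma subst_ctx_lam_depth (L : ctx) : subst_ctx L -> lam_depth L = 0.
Proof. induction L; simpl; tauto. Qed.

Lemma lam_depth_comp (E C D : ctx) :
  lam_depth C = lam_depth D -> lam_depth (comp E C) = lam_depth (comp E D).
Proof. induction E; simpl; auto. Qed.

(** Relative unfolding works from the hole outwards: [E] sees what lies below it only through that
    result and the [lam_depth] which indexes its substitutions. *)
Lemma rel_unf_comp (E C D : ctx) (t u : term) :
  lam_depth C = lam_depth D -> rel_unf t C = rel_unf u D ->
  rel_unf t (comp E C) = rel_unf u (comp E D).
Proof.
  intros Hd H; induction E; simpl; auto.
  now rewrite IHE, (lam_depth_comp E C D).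
Qed.

(** Each substitution of [E] enters the abstraction under one more [up]; the innermost [CLam]
    supplies it by raising [lam_depth]. *)
Lemma rel_unf_Lam (E : ctx) (t : term) :
  rel_unf (Lam t) E = Lam (rel_unf t (comp E (CLam Hole))).
Proof.
  induction E; simpl; auto.
  rewrite IHE.
  replace (lam_depth (comp E (CLam Hole))) with (S (lam_depth E))
    by (clear; induction E; simpl; auto).
  reflexivity.
Qed.

Lemma rel_unf_AppL (E : ctx) (t u : term) :
  rel_unf t (comp E (CAppL Hole u)) = rel_unf t E.
Proof. rewrite <- (comp_Hole E) at 2; now apply rel_unf_comp. Qed.

Lemma rel_unf_AppR (E : ctx) (t u : term) :
  rel_unf u (comp E (CAppR t Hole)) = rel_unf u E.
Proof. rewrite <- (comp_Hole E) at 2; now apply rel_unf_comp. Qed.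

Lemma rel_unf_App (E : ctx) (t u : term) :
  rel_unf (App t u) E = App (rel_unf t E) (rel_unf u E).
Proof. induction E; simpl; auto; now rewrite IHE. Qed.

Lemma rel_unf_SubL (E : ctx) (t u : term) :
  rel_unf t (comp E (CSubL Hole u)) = rel_unf (Sub t u) E.
Proof. rewrite <- (comp_Hole E) at 2; now apply rel_unf_comp. Qed.

(** With its variable treated as an abstracted one, the innermost substitution commutes with those
    of [E] by the substitution lemma [subst_msubst]. *)
Lemma rel_unf_Sub (E : ctx) (t u : term) :
  rel_unf (Sub t u) E = msubst 0 (rel_unf u E) (rel_unf t (comp E (CLam Hole))).
Proof.
  induction E; simpl; auto.
  rewrite IHE; unfold msubst at 1; rewrite subst_msubst.
  replace (lam_depth (comp E (CLam Hole))) with (S (lam_depth E))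
    by (clear; induction E; simpl; auto).
  reflexivity.
Qed.

Lemma rel_unf_plug_subst_ctx (L : ctx) : subst_ctx L -> forall E t,
  rel_unf (plug L t) E = rel_unf t (comp E L).
Proof.
  induction L; simpl; try contradiction; intros HL E t0.
  - now rewrite comp_Hole.
  - rewrite <- rel_unf_SubL, IHL by assumption; now rewrite comp_assoc.
Qed.

Lemma lambda_term_rel_unf (t : term) (E : ctx) : lambda_term (rel_unf t E).
Proof.
  induction E; simpl; auto using lambda_term_unf.
  apply lambda_term_subst; auto.
  intro n; destruct (Nat.lt_ge_cases n (lam_depth E)) as [H|H].
  - now rewrite iter_up_lt.
  - replace n with (lam_depth E + (n - lam_depth E)) by lia.
    rewrite iter_up_add; apply lambda_term_ren.
    destruct (n - lam_depth E); simpl; auto using lambda_term_unf.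
Qed.

(** A term lifted past [C] mentions no binder of [C]: each substitution cancels one lift, and each
    abstraction keeps its own. *)
Lemma rel_unf_lift (C : ctx) : shallow C -> forall t,
  rel_unf (lift (depth C) t) C = lift (lam_depth C) (unf t).
Proof.
  induction C; simpl; try contradiction; intros HC t0.
  - rewrite !lift0; reflexivity.
  - rewrite <- (Nat.add_1_r (depth C)), <- lift_lift, IHC by assumption.
    now rewrite unf_lift, lift_lift, Nat.add_1_r.
  - now apply IHC.
  - now apply IHC.
  - rewrite <- (Nat.add_1_r (depth C)), <- lift_lift, IHC by assumption.
    rewrite unf_lift; apply msubst_lift.
Qed.

(** The substitution that binds [x] turns it into the unfolding of [u], and acts vacuously on the
    copy [r] of [u]. *)
Lemma rel_unf_ls (E : ctx) (x : nat) (r : term) :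
  ls_compact E x r -> rel_unf r E = rel_unf (Var x) E.
Proof.
  intros (D & C & u & HD & HC & -> & -> & ->).
  apply rel_unf_comp; auto; simpl.
  rewrite <- (Nat.add_1_r (depth C)), <- lift_lift, rel_unf_lift by assumption.
  rewrite unf_lift, msubst_lift.
  (* The variable of index [depth C] is [Var 0] lifted past [C], so it unfolds to index
     [lam_depth C], the one replaced by [msubst]. *)
  assert (Hx := rel_unf_lift C HC (Var 0)).
  unfold lift in Hx; simpl in Hx; rewrite !Nat.add_0_r in Hx.
  now rewrite Hx, msubst_Var_eq.
Qed.

(* In the first case, x is free in E or bound by an abstraction of E. *)
Lemma rel_unf_Var_cases (E : ctx) (x : nat) : shallow E ->
  (exists y, rel_unf (Var x) E = Var y /\
     (y < lam_depth E \/ exists n, y = lam_depth E + n /\ x = depth E + n)) \/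
  exists r, ls_compact E x r.
Proof.
  unfold ls_compact.
  induction E as [|E IH|E IH v|w E IH|E IH v|w E IH]; simpl; intro HE;
    try contradiction.
  - left; exists x; split; auto; right; now exists x.
  - destruct (IH HE) as [(y & Hy & H)|(r & D & C & u & HD & HC & -> & -> & ->)].
    + left; exists y; split; auto.
      destruct H as [H|([|n] & -> & ->)]; [left; lia|left; lia|].
      right; exists n; lia.
    + right; eexists; exists (CLam D), C, u; simpl; auto.
  - destruct (IH HE) as [(y & Hy & H)|(r & D & C & u & HD & HC & -> & -> & ->)].
    + left; eauto.
    + right; eexists; exists (CAppL D v), C, u; simpl; auto.
  - destruct (IH HE) as [(y & Hy & H)|(r & D & C & u & HD & HC & -> & -> & ->)].
    + left; eauto.
    + right; eexists; exists (CAppR w D), C, u; simpl; auto.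
  - destruct (IH HE) as [(y & Hy & H)|(r & D & C & u & HD & HC & -> & -> & ->)].
    + rewrite Hy.
      (* Either [y] is abstracted in [E], or it is the variable of this substitution ([n = 0]) and
         an ls-redex appears, or it comes from further out and is decremented. *)
      destruct H as [H|([|n] & -> & ->)].
      * left; exists y; unfold msubst; simpl; rewrite iter_up_lt; auto.
      * right; eexists; exists Hole, E, v; simpl; rewrite Nat.add_0_r; auto.
      * left; exists (lam_depth E + n); unfold msubst; simpl.
        rewrite iter_up_add; simpl; split; auto.
        right; exists n; lia.
    + right; eexists; exists (CSubL D v), C, u; simpl; auto.
Qed.

(* The unfolding of C relatively to E: the position, in the unfolding of
   E<C<t>> below the image of E, of the subterm t.  Only shallow C are
   meaningful. *)
Fixpoint unf_ctx (E C : ctx) : ctx :=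
  match C with
  | Hole => Hole
  | CLam C => CLam (unf_ctx (comp E (CLam Hole)) C)
  | CAppL C u => CAppL (unf_ctx (comp E (CAppL Hole u)) C) (rel_unf u E)
  | CAppR t C => CAppR (rel_unf t E) (unf_ctx (comp E (CAppR t Hole)) C)
  | CSubL C u => unf_ctx (comp E (CSubL Hole u)) C
  | CSubR t C => Hole
  end.

Lemma rel_unf_plug (C : ctx) : shallow C -> forall E t,
  rel_unf (plug C t) E = plug (unf_ctx E C) (rel_unf t (comp E C)).
Proof.
  induction C; simpl; try contradiction; intros HC E t0.
  - now rewrite comp_Hole.
  - rewrite rel_unf_Lam, IHC by assumption; now rewrite comp_assoc.
  - rewrite rel_unf_App, <- (rel_unf_AppL E (plug C t0) t), IHC by assumption.
    now rewrite comp_assoc.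
  - rewrite rel_unf_App, <- (rel_unf_AppR E t (plug C t0)), IHC by assumption.
    now rewrite comp_assoc.
  - rewrite <- rel_unf_SubL, IHC by assumption; now rewrite comp_assoc.
Qed.

Lemma unf_plug (C : ctx) (t : term) : shallow C ->
  unf (plug C t) = plug (unf_ctx Hole C) (rel_unf t C).
Proof. intro HC; apply (rel_unf_plug C HC Hole). Qed.

(** Unfolding makes [L] vanish from the lifted argument, so this is the beta-contractum of the term
    in [rel_unf_dB_redex]. *)
Lemma rel_unf_dB_reduct (E L : ctx) (s v : term) : subst_ctx L ->
  rel_unf (plug L (Sub s (lift (depth L) v))) E =
  msubst 0 (rel_unf v E) (rel_unf s (comp (comp E L) (CLam Hole))).
Proof.
  intro HL; rewrite rel_unf_plug_subst_ctx, rel_unf_Sub by assumption; f_equal.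
  rewrite <- (comp_Hole E) at 2; apply rel_unf_comp.
  - now apply subst_ctx_lam_depth.
  - rewrite rel_unf_lift by now apply subst_ctx_shallow.
    rewrite subst_ctx_lam_depth by assumption; apply lift0.
Qed.

Lemma rel_unf_dB_redex (E L : ctx) (s v : term) : subst_ctx L ->
  rel_unf (App (plug L (Lam s)) v) E =
  App (Lam (rel_unf s (comp (comp E L) (CLam Hole)))) (rel_unf v E).
Proof.
  intro HL; now rewrite rel_unf_App, rel_unf_plug_subst_ctx, rel_unf_Lam.
Qed.

(** * The left-to-right outside-in order *)

(** A structural weakening of [prec_LO] that ignores side terms: impossible comparisons compute to
    [False], and a common outer constructor cancels. *)
Fixpoint before (C D : ctx) : Prop :=
  match C, D with
  | Hole, Hole => False
  | Hole, _ => True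
  | CLam C, CLam D => before C D
  | CAppL C _, CAppL D _ => before C D
  | CAppR _ C, CAppR _ D => before C D
  | CSubL C _, CSubL D _ => before C D
  | CSubR _ C, CSubR _ D => before C D
  | CAppL _ _, CAppR _ _ => True
  | CSubL _ _, CSubR _ _ => True
  | _, _ => False
  end.

Lemma before_comp (E C D : ctx) : before (comp E C) (comp E D) <-> before C D.
Proof. induction E; simpl; tauto. Qed.

Lemma prec_LO_before (C D : ctx) : prec_LO C D -> before C D.
Proof.
  intros [H|H]; induction H; simpl; auto; try now apply before_comp.
  destruct C; simpl; auto.
Qed.

Lemma prec_LO_comp (E C D : ctx) :
  prec_LO C D -> prec_LO (comp E C) (comp E D).
Proof. intros [H|H]; [left|right]; now constructor. Qed.

(** * Redexes of the unfolding come from useful redexes *)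

Lemma useful_dB (E L : ctx) (s v : term) : shallow E -> subst_ctx L ->
  exists t', useful_step DB E (plug E (App (plug L (Lam s)) v)) t'.
Proof. intros HE HL; eexists; split; [now constructor|now left]. Qed.

Lemma useful_ls (E : ctx) (x : nat) (r : term) : ls_compact E x r ->
  has_beta_redex (rel_unf (Var x) E) \/
    is_abs (rel_unf (Var x) E) /\ applicative E ->
  useful_step LS E (plug E (Var x)) (plug E r).
Proof.
  intros Hls H; split; [now constructor|right; split; auto].
  exists r; split; auto; now rewrite (rel_unf_ls E x).
Qed.

(** Strip the outer substitutions of [w]: an application would unfold to an application, so what
    remains is an abstraction or a variable to be replaced. *)
Lemma abs_rel_unf (w : term) : forall E,
  shallow E -> is_abs (rel_unf w E) ->
  exists L, subst_ctx L /\
    ((exists s, w = plug L (Lam s)) \/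
     exists x r, w = plug L (Var x) /\ ls_compact (comp E L) x r /\
       is_abs (rel_unf (Var x) (comp E L))).
Proof.
  induction w as [x|w IH|w1 IH1 w2 IH2|w IH v IHv]; intros E HE Habs.
  - exists Hole; split; [exact I|right].
    destruct (rel_unf_Var_cases E x HE) as [(y & Hy & _)|[r Hr]].
    + destruct Habs as [s Hs]; congruence.
    + exists x, r; now rewrite comp_Hole.
  - exists Hole; split; [exact I|left; now exists w].
  - destruct Habs as [s Hs]; rewrite rel_unf_App in Hs; discriminate.
  - rewrite <- rel_unf_SubL in Habs.
    destruct (IH (comp E (CSubL Hole v)))
      as (L & HL & [(s & ->)|(x & r & -> & H)]); auto.
    + now apply shallow_comp.
    + exists (CSubL L v); split; [exact HL|left; now exists s].
    + exists (CSubL L v); rewrite comp_assoc in H; split; auto.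
      right; exists x, r; auto.
Qed.

Lemma beta_step_inv (D : ctx) (t t' : term) : beta_step D t t' ->
  exists s v, t = plug D (App (Lam s) v).
Proof. intros [C s v _]; eauto. Qed.

Lemma has_beta_redex_rel_unf (t : term) (E D : ctx) (s v : term) :
  rel_unf t E = plug D (App (Lam s) v) -> has_beta_redex (rel_unf t E).
Proof.
  intro H; rewrite H; exists D; eexists; constructor.
  rewrite <- H; apply lambda_term_rel_unf.
Qed.

(** An abstraction already in place gives a dB-redex at the application; one hidden behind a
    variable gives an ls-redex in applicative position. The bound on [D] places both before every
    position in [v]. *)
Lemma abs_useful (w v : term) (E : ctx) :
  shallow E -> is_abs (rel_unf w E) ->
  exists k D t', useful_step k (comp E D) (plug E (App w v)) t' /\
    (D = Hole \/ exists D', D = CAppL D' v).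
Proof.
  intros HE Habs.
  destruct (abs_rel_unf w (comp E (CAppL Hole v)))
    as (L & HL & [(s & ->)|(x & r & -> & Hls & Hx)]).
  - now apply shallow_comp.
  - now rewrite rel_unf_AppL.
  - destruct (useful_dB E L s v HE HL) as [t' H].
    exists DB, Hole, t'; rewrite comp_Hole; auto.
  - rewrite comp_assoc in *; simpl in *.
    exists LS, (CAppL L v); eexists; split; eauto.
    change (App (plug L (Var x)) v) with (plug (CAppL L v) (Var x)).
    rewrite <- plug_comp; apply useful_ls; eauto.
    right; split; auto; exists E, L, v; auto.
Qed.

Lemma beta_redex_useful (w : term) : forall E,
  shallow E -> has_beta_redex (rel_unf w E) ->
  exists k D t', useful_step k (comp E D) (plug E w) t'.
Proof.
  induction w as [x|w IH|w1 IH1 w2 IH2|w IH v IHv]; intros E HE Hred.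
  - destruct (rel_unf_Var_cases E x HE) as [(y & Hy & _)|[r Hr]].
    + rewrite Hy in Hred; destruct Hred as (D & t' & H).
      destruct (beta_step_inv _ _ _ H) as (s & v & He).
      destruct D; discriminate.
    + exists LS, Hole; eexists; rewrite comp_Hole.
      apply useful_ls; eauto.
  - destruct Hred as (D & t' & H).
    destruct (beta_step_inv _ _ _ H) as (s & v & He).
    rewrite rel_unf_Lam in He.
    destruct D; try discriminate; injection He as He.
    destruct (IH (comp E (CLam Hole))) as (k & Q & s' & HQ).
    + now apply shallow_comp.
    + eapply has_beta_redex_rel_unf; eauto.
    + rewrite comp_assoc, plug_comp in HQ; eauto.
  - destruct Hred as (D & t' & H).
    destruct (beta_step_inv _ _ _ H) as (s & v & He).
    rewrite rel_unf_App in He.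
    destruct D; try discriminate; injection He as He1 He2.
    + destruct (abs_useful w1 w2 E HE) as (k & D & t'' & HD & _).
      * now exists s.
      * eauto.
    + destruct (IH1 (comp E (CAppL Hole w2))) as (k & Q & s' & HQ).
      * now apply shallow_comp.
      * rewrite <- (rel_unf_AppL E w1 w2) in He1.
        eapply has_beta_redex_rel_unf; eauto.
      * rewrite comp_assoc, plug_comp in HQ; eauto.
    + destruct (IH2 (comp E (CAppR w1 Hole))) as (k & Q & s' & HQ).
      * now apply shallow_comp.
      * rewrite <- (rel_unf_AppR E w1 w2) in He2.
        eapply has_beta_redex_rel_unf; eauto.
      * rewrite comp_assoc, plug_comp in HQ; eauto.
  (* Only the body is searched: copies of [v] in the unfolding sit at variable occurrences, where
     the ls-step is itself useful. *)
  - rewrite <- rel_unf_SubL in Hred.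
    destruct (IH (comp E (CSubL Hole v))) as (k & Q & s' & HQ); auto.
    + now apply shallow_comp.
    + rewrite comp_assoc, plug_comp in HQ; eauto.
Qed.

(** The path to the application crosses substitutions until it meets an abstraction; it ends in an
    application, so no variable can be the source. *)
Lemma abs_plug_App (C : ctx) : shallow C -> forall E a b,
  is_abs (rel_unf (plug C (App a b)) E) ->
  exists L s, subst_ctx L /\ plug C (App a b) = plug L (Lam s).
Proof.
  induction C; simpl; try contradiction; intros HC E a b H.
  - destruct H as [s H]; rewrite rel_unf_App in H; discriminate.
  - exists Hole; eexists; split; [exact I|reflexivity].
  - destruct H as [s H]; rewrite rel_unf_App in H; discriminate.
  - destruct H as [s H]; rewrite rel_unf_App in H; discriminate.
  - rewrite <- rel_unf_SubL in H.
    destruct (IHC HC _ _ _ H) as (L & s & HL & ->).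
    now exists (CSubL L t), s.
Qed.

(* E is the part of the position already crossed by the induction. *)
Lemma unf_ctx_LO (C : ctx) : shallow C -> forall E a b,
  shallow E ->
  (forall k Q t', useful_step k (comp E Q) (plug E (plug C (App a b))) t' ->
     (k, Q) <> (DB, C) -> before C Q) ->
  forall D t', beta_step D (rel_unf (plug C (App a b)) E) t' ->
    D <> unf_ctx E C -> prec_LO (unf_ctx E C) D.
Proof.
  intros HC E a b HE Hmin D t' Hbeta Hne.
  destruct (beta_step_inv _ _ _ Hbeta) as (s & v & He); clear Hbeta t'.
  revert HC E HE Hmin D He Hne.
  induction C as [|C IH|C IH u|w C IH|C IH u|w C IH]; simpl; try contradiction;
    intros HC E HE Hmin D He Hne.
  - left; now constructor.
  - rewrite rel_unf_Lam in He.
    destruct D; try discriminate; injection He as He.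
    apply (prec_LO_comp (CLam Hole)); apply IH; auto; try congruence.
    + now apply shallow_comp.
    + intros k Q t'; rewrite comp_assoc, plug_comp; intros HQ HneQ.
      apply (Hmin _ _ _ HQ); simpl; congruence.
  - rewrite rel_unf_App in He.
    destruct D as [| |D| D' D| |]; try discriminate; injection He as He1 He2.
    (* A beta-redex at the root would make this application a dB-redex, which lies outside the
       minimal one. *)
    + exfalso.
      destruct (abs_plug_App C HC E a b) as (L & s' & HL & Heq).
      { now exists s. }
      rewrite Heq in Hmin.
      destruct (useful_dB E L s' u HE HL) as [t' H].
      rewrite <- (comp_Hole E) in H at 1.
      apply (Hmin _ _ _ H); congruence.
    + subst; apply (prec_LO_comp (CAppL Hole (rel_unf u E))).
      apply IH; auto; try congruence.
      * now apply shallow_comp.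
      * intros k Q t'; rewrite comp_assoc, plug_comp; intros HQ HneQ.
        apply (Hmin _ _ _ HQ); simpl; congruence.
      * now rewrite rel_unf_AppL.
    + right; rewrite <- He1, He2.
      apply prec_L_app; [|eexists; reflexivity].
      rewrite <- (rel_unf_AppL E _ u), rel_unf_plug by assumption.
      eexists; reflexivity.
  - rewrite rel_unf_App in He.
    destruct D as [| |D| D' D| |]; try discriminate; injection He as He1 He2.
    (* Here and in the next case, the useful redex obtained lies at the application or in its left
       subterm, hence cannot come after a position in the right subterm. *)
    + exfalso.
      destruct (abs_useful w (plug C (App a b)) E HE)
        as (k & Q & t' & HQ & [->|[Q' ->]]).
      * now exists s.
      * apply (Hmin _ _ _ HQ); congruence.
      * apply (Hmin _ _ _ HQ); congruence.
    + exfalso.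
      destruct (beta_redex_useful w (comp E (CAppL Hole (plug C (App a b)))))
        as (k & Q & t' & HQ).
      * now apply shallow_comp.
      * rewrite <- (rel_unf_AppL E w (plug C (App a b))) in He1.
        eapply has_beta_redex_rel_unf; eauto.
      * rewrite comp_assoc, plug_comp in HQ.
        apply (Hmin _ _ _ HQ); simpl; congruence.
    + subst; apply (prec_LO_comp (CAppR (rel_unf w E) Hole)).
      apply IH; auto; try congruence.
      * now apply shallow_comp.
      * intros k Q t'; rewrite comp_assoc, plug_comp; intros HQ HneQ.
        apply (Hmin _ _ _ HQ); simpl; congruence.
      * now rewrite rel_unf_AppR.
  (* [unf_ctx] erases the substitution, so [D] stays the same and only [E] grows. *)
  - rewrite <- rel_unf_SubL in He.
    apply IH; auto.
    + now apply shallow_comp.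
    + intros k Q t'; rewrite comp_assoc, plug_comp; intros HQ HneQ.
      apply (Hmin _ _ _ HQ); simpl; congruence.
Qed.

(** * Projection of single steps on the unfolding *)

Lemma unf_lou_LS (C : ctx) (t s : term) :
  lou_step (LS, C) t s -> unf t = unf s.
Proof.
  intros [[Hstep _] _]; simpl in Hstep.
  inversion Hstep as [|E x r Hls]; subst.
  assert (HC : shallow C).
  { destruct Hls as (D & C' & u & HD & HC' & -> & _).
    now apply shallow_comp. }
  (* The unfolding depends on the plugged term only through its relative unfolding, which the
     ls-step preserves. *)
  now rewrite !unf_plug, (rel_unf_ls C x r).
Qed.

Lemma unf_lou_DB (C : ctx) (t s : term) :
  lou_step (DB, C) t s -> lo_beta_step (unf_ctx Hole C) (unf t) (unf s).
Proof.
  intros [[Hstep _] Hmin]; simpl in Hstep, Hmin.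
  inversion Hstep as [C' L b v HC HL|]; subst; split.
  - rewrite !unf_plug, rel_unf_dB_reduct, rel_unf_dB_redex by assumption.
    constructor.
    rewrite <- rel_unf_dB_redex, <- unf_plug by assumption.
    apply lambda_term_unf.
  - apply (unf_ctx_LO C HC Hole); [exact I|].
    intros k Q t' HQ Hne.
    apply prec_LO_before, (Hmin (k, Q) t' HQ Hne).
Qed.

Theorem mainTheorem5 (t u : term) (rho : derivation lou_step t u) :
  exists rho' : derivation lo_beta_step (unf t) (unf u),
    deriv_length rho' = dB_length rho.
Proof.
  induction rho as [t|[[|] C] t s u Hstep rho [rho' IH]]; simpl.
  - now exists (deriv_nil (unf t)).
  - exists (deriv_cons _ (unf_lou_DB C t s Hstep) rho'); simpl; congruence.
  - rewrite (unf_lou_LS C t s Hstep); eauto.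
Qed.
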